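(* Let $A\in\mathbb{R}^{n\times n}$ be such that the set $\Lambda_1$ of rightmost eigenvalues of $A$ is single complex, and use the Euclidean norm as vector norm. Let $y_0\in\mathbb{R}^n$ and $\widehat z_0\in\mathbb{R}^n$ with $\|\widehat z_0\|_2=1$, $w^{(1)}y_0\ne0$, $w^{(1)}\widehat z_0\neq0$, and put $\widehat y_0:=y_0/\|y_0\|_2$. Then $$\max_{t\in\mathbb{R}}\mathrm{OT}(t,y_0,\widehat z_0)=G^{\max}_{V_1}\big(\gamma_1(\widehat z_0)-\gamma_1(\widehat y_0)\big)$$ and $$\min_{t\in\mathbb{R}}\mathrm{OT}(t,y_0,\widehat z_0)=G^{\min}_{V_1}\big(\gamma_1(\widehat z_0)-\gamma_1(\widehat y_0)\big).$$
   Context: The spectrum of $A$ is partitioned by real parts into $\Lambda_1,\dots,\Lambda_q$ with $\Lambda_1$ the set of eigenvalues of largest real part. $\Lambda_1$ is single complex if it consists of a complex conjugate pair $\lambda_1,\overline{\lambda_1}$ of non-real eigenvalues, each having exactly one Jordan block of maximum order; $\lambda_1$ is the one with positive imaginary part $\omega_1>0$. Let $V$ be an invertible matrix whose columns form a Jordan basis for $A$ and $W=V^{-1}$. Let $v^{(1,1)},\dots,v^{(1,M_1)}$ (columns of $V$) be the unique longest Jordan chain for $\lambda_1$, with $v^{(1,1)}$ an eigenvector; put $v^{(1)}:=v^{(1,1)}$ and let $w^{(1)}$ be the row of $W$ whose index equals the column index of $v^{(1,M_1)}$ in $V$. The basis is chosen so that $\overline{v^{(1,1)}},\dots,\overline{v^{(1,M_1)}}$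 are columns of $V$ forming the longest Jordan chain for $\overline{\lambda_1}$ and the row of $W$ corresponding to $\overline{v^{(1,M_1)}}$ is $\overline{w^{(1)}}$. Put $\widehat v^{(1)}:=v^{(1)}/\|v^{(1)}\|_2$ and $\widehat w^{(1)}:=w^{(1)}/\|w^{(1)}\|_2$. $V_1:=|(\widehat v^{(1)})^T\widehat v^{(1)}|$ (transpose without conjugation); one has $V_1\in[0,1)$. For $u\in\mathbb{R}^n$ with $\widehat w^{(1)}u\ne 0$, $\gamma_1(u)$ is the angle in the polar form $\widehat w^{(1)}u=|\widehat w^{(1)}u|\mathrm{e}^{\mathrm{i}\gamma_1(u)}$. Writing $\widehat v^{(1)}_k=|\widehat v^{(1)}_k|\mathrm{e}^{\mathrm{i}\alpha_{1k}}$, put $$\widehat\Theta_1(t,u):=\big(|\widehat v^{(1)}_k|\cos(\omega_1t+\alpha_{1k}+\gamma_1(u))\big)_{k=1,\dots,n}\in\mathbb{R}^n .$$ The oscillating term is $\mathrm{OT}(t,y_0,\widehat z_0):=\|\widehat\Theta_1(t,\widehat z_0)\|_2/\|\widehat\Theta_1(t,\widehat y_0)\|_2$. For $V,W\in[0,1)$ (now numbers), $f_{VW}(\alpha,x):=\dfrac{1+V\cos(x+\alpha)}{1-W\cos\alpha}$, $f^{\max}_{VW}(x):=\max_{\alpha\in\mathbb{R}}f_{VW}(\alpha,x)$, $f^{\min}_{VW}(x):=\min_{\alpha\in\mathbb{R}}f_{VW}(\alpha,x)$. Then $G^{\max}_{V_1}(\gamma):=\sqrt{f^{\max}_{V_1V_1}(2\gamma-\pi)}$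 and $G^{\min}_{V_1}(\gamma):=\sqrt{f^{\min}_{V_1V_1}(2\gamma-\pi)}$, $\gamma\in\mathbb{R}$ (both subscripts of $f$ equal to $V_1$). *)

(* Defs.v *)
From mathcomp Require Export all_boot all_order all_algebra.
From mathcomp Require Export complex.
From mathcomp Require Export all_classical all_reals all_analysis.

Set Implicit Arguments.
Unset Strict Implicit.
Unset Printing Implicit Defensive.

Import Order.TTheory GRing.Theory Num.Theory.

Local Open Scope classical_set_scope.
Local Open Scope ring_scope.
Local Open Scope complex_scope.

Definition is_max (R : realType) (E : set R) (m : R) : Prop :=
  E m /\ ubound E m.

Definition is_min (R : realType) (E : set R) (m : R) : Prop :=
  E m /\ lbound E m.

(* The maximum (minimum) of E as a value; 0 when E has none. *)
Definition max_of (R : realType) (E : set R) : R := xget 0 [set m | is_max E m].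

Definition min_of (R : realType) (E : set R) : R := xget 0 [set m | is_min E m].

(* `|_| on matrices is the maximum norm and `|_| on R[i] is R[i]-valued, hence
   the Euclidean norms and the real-valued modulus below. *)
Definition cmod (R : realType) (z : R[i]) : R :=
  Num.sqrt (complex.Re z ^+ 2 + complex.Im z ^+ 2).

Definition norm2 (R : realType) (n : nat) (x : 'cV[R]_n) : R :=
  Num.sqrt (\sum_k x k 0 ^+ 2).

(* Used for row vectors (m = 1) and column vectors (n = 1). *)
Definition cnorm2 (R : realType) (m n : nat) (u : 'M[R[i]]_(m, n)) : R :=
  Num.sqrt (\sum_i \sum_j cmod (u i j) ^+ 2).

Definition normalize (R : realType) (n : nat) (x : 'cV[R]_n) : 'cV[R]_n :=
  (norm2 x)^-1 *: x.

Definition cnormalize (R : realType) (m n : nat) (u : 'M[R[i]]_(m, n)) :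
    'M[R[i]]_(m, n) :=
  ((cnorm2 u)^-1)%:C *: u.

Definition cplx_mx (R : realType) (m n : nat) (M : 'M[R]_(m, n)) :
    'M[R[i]]_(m, n) :=
  \matrix_(i, j) (M i j)%:C.

Definition conj_mx (R : realType) (m n : nat) (M : 'M[R[i]]_(m, n)) :
    'M[R[i]]_(m, n) :=
  \matrix_(i, j) (M i j)^*.

Definition mx11 (R : realType) (M : 'M[R[i]]_1) : R[i] := M 0 0.

(* z = |z| e^{i theta} *)
Definition is_angle (R : realType) (z : R[i]) (theta : R) : Prop :=
  z = (cmod z)%:C * (cos theta +i* sin theta).

(* vs = [:: v_1; ...; v_m] is a Jordan chain: v_1 is an eigenvector for lam and
   (A - lam I) v_(k+1) = v_k; the shifted list 0 :: vs gives both equations. *)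
Definition jordan_chain (R : realType) (n : nat) (A : 'M[R[i]]_n) (lam : R[i])
    (vs : seq 'cV[R[i]]_n) : Prop :=
  [/\ (0 < size vs)%N, nth 0 vs 0 != 0
    & forall k, (k < size vs)%N ->
        (A - lam%:M) *m nth 0 vs k = nth 0 (0 :: vs) k].

(* bs lists, for each Jordan block, its eigenvalue and the indices of the columns
   of V forming the associated chain, eigenvector first.  The columns of a
   chain need not be adjacent in V. *)
Definition jordan_basis (R : realType) (n : nat) (A : 'M[R]_n)
    (V : 'M[R[i]]_n) (bs : seq (R[i] * seq 'I_n)) : Prop :=
  [/\ V \in unitmx,
      perm_eq (flatten [seq b.2 | b <- bs]) (enum 'I_n)
    & forall b, b \in bs ->
        jordan_chain (cplx_mx A) b.1 [seq col j V | j <- b.2]].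

Definition longest_chain (R : realType) (n : nat) (bs : seq (R[i] * seq 'I_n))
    (lam : R[i]) (c : seq 'I_n) : Prop :=
  (lam, c) \in bs /\
  forall c' : seq 'I_n, (lam, c') \in bs -> (size c' <= size c)%N.

Definition rightmost (R : realType) (n : nat) (A : 'M[R]_n) : set R[i] :=
  [set lam | eigenvalue (cplx_mx A) lam /\
     forall mu, eigenvalue (cplx_mx A) mu ->
       complex.Re mu <= complex.Re lam].

(* Chains of a Jordan basis are disjoint and correspond to the Jordan blocks of
   A, whose multiset of eigenvalues and orders does not depend on the basis. *)
Definition single_complex (R : realType) (n : nat) (A : 'M[R]_n) : Prop :=
  exists lam : R[i],
    [/\ complex.Im lam != 0,
        rightmost A = [set lam; lam^*]
      & exists (V : 'M[R[i]]_n) (bs : seq (R[i] * seq 'I_n)),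
          jordan_basis A V bs /\
          forall mu, rightmost A mu -> exists! c, longest_chain bs mu c].

Definition Theta (R : realType) (n : nat) (omega : R) (vh : 'cV[R[i]]_n)
    (alpha : 'I_n -> R) (gamma : 'cV[R]_n -> R) (t : R) (u : 'cV[R]_n) :
    'cV[R]_n :=
  \col_k (cmod (vh k 0) * cos (omega * t + alpha k + gamma u)).

Definition OT (R : realType) (n : nat) (omega : R) (vh : 'cV[R[i]]_n)
    (alpha : 'I_n -> R) (gamma : 'cV[R]_n -> R) (t : R) (y0 z0 : 'cV[R]_n) : R :=
  norm2 (Theta omega vh alpha gamma t z0) /
  norm2 (Theta omega vh alpha gamma t (normalize y0)).

Definition V1 (R : realType) (n : nat) (vh : 'cV[R[i]]_n) : R :=
  cmod (mx11 (vh^T *m vh)).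

Definition fVW (R : realType) (V W alpha x : R) : R :=
  (1 + V * cos (x + alpha)) / (1 - W * cos alpha).

Definition fmax (R : realType) (V W x : R) : R :=
  max_of (range (fun alpha => fVW V W alpha x)).

Definition fmin (R : realType) (V W x : R) : R :=
  min_of (range (fun alpha => fVW V W alpha x)).

Definition Gmax (R : realType) (V gamma : R) : R :=
  Num.sqrt (fmax V V (2 * gamma - pi)).

Definition Gmin (R : realType) (V gamma : R) : R :=
  Num.sqrt (fmin V V (2 * gamma - pi)).

(* Main.v *)
(* Put vh^T vh = V1 e^{i delta} for the normalized eigenvector vh.  Since
   Re(z)^2 = (|z|^2 + Re(z^2)) / 2, one gets
   |Theta(t, u)|^2 = (1 + V1 cos(2 (omega t + gamma u) + delta)) / 2, so
   OT(t)^2 = f(a, 2 (gamma z0 - gamma y0) - pi) with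
   a = 2 (omega t + gamma y0) + delta + pi, which runs over all reals.  The
   extrema of f over a exist by compactness of the circle because V1 < 1. *)
From mathcomp Require Import ring lra.
Require Import Defs.

Set Implicit Arguments.
Unset Strict Implicit.
Unset Printing Implicit Defensive.

Import Order.TTheory GRing.Theory Num.Theory.
Import numFieldNormedType.Exports.

Local Open Scope classical_set_scope.
Local Open Scope ring_scope.
Local Open Scope complex_scope.

(** * Polar form of complex numbers *)

Section Circle.
Variable R : realType.
Implicit Types (x y a : R) (z : R[i]).

(** The angle is [acos x] or its opposite, according to the sign of [y]. Confining it to a compact
    interval is what later makes the extreme value theorem applicable. *)
Lemma unit_circle_angle x y : x ^+ 2 + y ^+ 2 = 1 ->
  exists2 a, a \in `[- pi, pi] & cos a = x /\ sin a = y.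
Proof.
move=> xy1; have x11 : -1 <= x <= 1 by have := sqr_ge0 y; nra.
have y2 : 1 - x ^+ 2 = y ^+ 2 by rewrite -xy1; ring.
have cosx : cos (acos x) = x by rewrite acosK.
have := acos_ge0 x11; have := acos_lepi x11; have [y0 xpi x0|y0 xpi x0] := leP 0 y.
  exists (acos x); first by rewrite in_itv /=; lra.
  by rewrite sin_acos // y2 sqrtr_sqr ger0_norm.
exists (- acos x); first by rewrite in_itv /=; lra.
by rewrite cosN sinN sin_acos // y2 sqrtr_sqr ltr0_norm // opprK.
Qed.

Lemma cmod_ge0 z : 0 <= cmod z.
Proof. exact: sqrtr_ge0. Qed.

Lemma cmod_sqr z : cmod z ^+ 2 = complex.Re z ^+ 2 + complex.Im z ^+ 2.
Proof. by rewrite sqr_sqrtr // addr_ge0 ?sqr_ge0. Qed.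

Lemma cmod0_eq z : cmod z = 0 -> z = 0.
Proof.
move=> z0; have := cmod_sqr z; rewrite z0 expr0n /= => /eqP.
rewrite eq_sym paddr_eq0 ?sqr_ge0 // !sqrf_eq0; case: z {z0} => a b /=.
by move=> /andP[/eqP-> /eqP->].
Qed.

Lemma polar_form z : exists a, is_angle z a.
Proof.
have [z0|zN0] := eqVneq (cmod z) 0.
  (* Every angle represents zero; 0 is an arbitrary choice. *)
  by exists 0; rewrite /is_angle z0 mul0r (cmod0_eq z0).
have [|a _ [ca sa]] :=
    @unit_circle_angle (complex.Re z / cmod z) (complex.Im z / cmod z).
  by rewrite !expr_div_n -mulrDl -cmod_sqr divff // expf_neq0.
exists a; rewrite /is_angle ca sa; case: z zN0 {ca sa} => p q zN0.
by simpc; congr (_ +i* _); rewrite mulrC divfK.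
Qed.

Lemma Re_angle z a : is_angle z a -> complex.Re z = cmod z * cos a.
Proof. by move=> {1}->; rewrite /=; ring. Qed.

Lemma Im_angle z a : is_angle z a -> complex.Im z = cmod z * sin a.
Proof. by move=> {1}->; rewrite /=; ring. Qed.

End Circle.

(** * Existence of the extrema of [fVW] over the angle *)

Section Extrema.
Variables (R : realType) (V : R).
Hypotheses (V_ge0 : 0 <= V) (V_lt1 : V < 1).

(** Keeps the denominator of [fVW] positive, and later the radicands in [OT]. *)
Lemma Vcos_bound (a : R) : - 1 < V * cos a < 1.
Proof.
have cb : `|cos a| <= 1 by rewrite ler_norml cos_geN1 cos_le1.
rewrite -ltr_norml normrM ger0_norm //.
by apply: le_lt_trans V_lt1; rewrite ler_piMr.
Qed.

(** [fVW] depends on [a] only through the point [(cos a, sin a)] of the unit circle, which also has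
    an angle in the compact interval. *)
Lemma fVW_mod2pi (x a : R) :
  exists2 b, b \in `[- pi, pi] & fVW V V a x = fVW V V b x.
Proof.
have [b bpi [cb sb]] := unit_circle_angle (cos2Dsin2 a).
by exists b => //; rewrite /fVW !cosD cb sb.
Qed.

Lemma fVW_continuous (x : R) : continuous (fun a => fVW V V a x).
Proof.
move=> a; apply: cvgM.
  apply: cvgD; first exact: cvg_cst.
  apply: cvgM; first exact: cvg_cst.
  apply: continuous_comp; last exact: continuous_cos.
  by apply: cvgD; [exact: cvg_cst|exact: cvg_id].
apply: cvgV; first by rewrite gt_eqF // subr_gt0; case/andP: (Vcos_bound a).
apply: cvgB; first exact: cvg_cst.
apply: cvgM; first exact: cvg_cst.
exact: continuous_cos.
Qed.

(** Rules out the default value 0 of [max_of]: a maximum over one period exists by continuity, and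
    by periodicity it bounds all values. *)
Lemma fmaxP (x : R) : is_max (range (fun a => fVW V V a x)) (fmax V V x).
Proof.
apply: (@xgetPex _ 0 [set m | is_max (range (fun a => fVW V V a x)) m]).
have [c _ cmax] : exists2 c, c \in `[- pi, pi] &
    forall t, t \in `[- pi, pi] -> fVW V V t x <= fVW V V c x.
  apply: EVT_max; first by have := pi_ge0 R; lra.
  exact/continuous_subspaceT/fVW_continuous.
exists (fVW V V c x); split; first by exists c.
by move=> _ [a _ <-]; have [b bpi ->] := fVW_mod2pi x a; exact: cmax.
Qed.

Lemma fminP (x : R) : is_min (range (fun a => fVW V V a x)) (fmin V V x).
Proof.
apply: (@xgetPex _ 0 [set m | is_min (range (fun a => fVW V V a x)) m]).
have [c _ cmin] : exists2 c, c \in `[- pi, pi] &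
    forall t, t \in `[- pi, pi] -> fVW V V c x <= fVW V V t x.
  apply: EVT_min; first by have := pi_ge0 R; lra.
  exact/continuous_subspaceT/fVW_continuous.
exists (fVW V V c x); split; first by exists c.
by move=> _ [a _ <-]; have [b bpi ->] := fVW_mod2pi x a; exact: cmin.
Qed.

End Extrema.

(** [Num.sqrt] is nondecreasing on the whole line, being 0 on negative numbers. *)
Lemma is_max_sqrt (R : realType) (E : set R) (m : R) :
  is_max E m -> is_max (Num.sqrt @` E) (Num.sqrt m).
Proof.
move=> [Em ubm]; split; first by exists m.
by move=> _ [a Ea <-]; apply/ler_wsqrtr/ubm.
Qed.

Lemma is_min_sqrt (R : realType) (E : set R) (m : R) :
  is_min E m -> is_min (Num.sqrt @` E) (Num.sqrt m).
Proof.
move=> [Em lbm]; split; first by exists m.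
by move=> _ [a Ea <-]; apply/ler_wsqrtr/lbm.
Qed.

(** * The oscillating term as a function of the phase *)

Section Oscillation.
Variables (R : realType) (n : nat).
Implicit Types (v : 'cV[R[i]]_n) (A : 'M[R]_n) (lam : R[i]).

Lemma Re_sum (I : finType) (F : I -> R[i]) :
  complex.Re (\sum_i F i) = \sum_i complex.Re (F i).
Proof. by apply: (big_morph (@complex.Re R)) => // -[? ?] [? ?]. Qed.

Lemma Im_sum (I : finType) (F : I -> R[i]) :
  complex.Im (\sum_i F i) = \sum_i complex.Im (F i).
Proof. by apply: (big_morph (@complex.Im R)) => // -[? ?] [? ?]. Qed.

Lemma cnorm2_col_sqr v :
  cnorm2 v ^+ 2 = \sum_k (complex.Re (v k 0) ^+ 2 + complex.Im (v k 0) ^+ 2).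
Proof.
rewrite sqr_sqrtr; first by apply: eq_bigr => k _; rewrite big_ord1 cmod_sqr.
by apply: sumr_ge0 => k _; rewrite big_ord1 sqr_ge0.
Qed.

Lemma cnorm2_eq0 v : cnorm2 v = 0 -> v = 0.
Proof.
move=> v0; have /eqP := cnorm2_col_sqr v; rewrite v0 expr0n /= eq_sym.
rewrite psumr_eq0 => [/allP vk0|k _]; last by rewrite addr_ge0 ?sqr_ge0.
apply/matrixP => k j; rewrite ord1 mxE; apply: cmod0_eq.
have := vk0 k (mem_index_enum k); rewrite implyTb -cmod_sqr sqrf_eq0.
by move/eqP.
Qed.

Lemma cnorm2_cnormalize v : v != 0 -> cnorm2 (cnormalize v) = 1.
Proof.
move=> vN0; have cN0 : cnorm2 v != 0.
  by apply: contraNneq vN0 => /cnorm2_eq0/eqP.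
have : cnorm2 (cnormalize v) ^+ 2 = 1.
  rewrite cnorm2_col_sqr.
  under eq_bigr => k _.
    rewrite (_ : _ + _ = (cnorm2 v)^-1 ^+ 2 *
      (complex.Re (v k 0) ^+ 2 + complex.Im (v k 0) ^+ 2)); first over.
    by rewrite mxE; case: (v k 0) => a b /=; ring.
  by rewrite -mulr_sumr -cnorm2_col_sqr -exprMn mulVf // expr1n.
move/eqP; rewrite -[X in _ == X](expr1n _ 2) eqrXn2 ?ler01 //; last first.
  exact: sqrtr_ge0.
by move/eqP.
Qed.

(* The summand is the square of the real part of e^{i phi} v_k. *)
Lemma sum_Re_rot_sqr v (phi delta : R) :
  cnorm2 v = 1 -> is_angle (mx11 (v^T *m v)) delta ->
  \sum_k (cos phi * complex.Re (v k 0) - sin phi * complex.Im (v k 0)) ^+ 2 =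
  (1 + V1 v * cos (2 * phi + delta)) / 2.
Proof.
move=> v1 hd.
have v1E : \sum_k (complex.Re (v k 0) ^+ 2 + complex.Im (v k 0) ^+ 2) = 1.
  by rewrite -cnorm2_col_sqr v1 expr1n.
have ReS : V1 v * cos delta =
    \sum_k (complex.Re (v k 0) ^+ 2 - complex.Im (v k 0) ^+ 2).
  rewrite /V1 -(Re_angle hd) /mx11 mxE Re_sum; apply: eq_bigr => k _.
  by rewrite mxE; case: (v k 0) => a b /=; ring.
have ImS : V1 v * sin delta =
    \sum_k (2 * (complex.Re (v k 0) * complex.Im (v k 0))).
  rewrite /V1 -(Im_angle hd) /mx11 mxE Im_sum; apply: eq_bigr => k _.
  by rewrite mxE; case: (v k 0) => a b /=; ring.
(* The addition formula leaves [delta] only in the products [V1 v * cos delta] and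
   [V1 v * sin delta], the real and imaginary parts of [v^T *m v]. *)
have -> : V1 v * cos (2 * phi + delta) =
    (cos phi ^+ 2 - sin phi ^+ 2) * (V1 v * cos delta) -
    2 * (cos phi * sin phi) * (V1 v * sin delta).
  by rewrite mulr_natl cosD mulr2n cosD sinD; ring.
(* The constant 1 becomes the sum of the squared moduli, and below it gains a factor
   [cos phi ^+ 2 + sin phi ^+ 2], so that the two sides agree term by term. *)
rewrite ReS ImS -[X in (X + _) / 2]v1E !mulr_sumr -sumrB -big_split mulr_suml /=.
apply: eq_bigr => k _.
rewrite -[X in (X + _) / 2](@mul1r R) -[X in (X * _ + _) / 2](cos2Dsin2 phi).
by field.
Qed.

(** By the polar form of [v k 0], each entry is the real part of [v k 0] rotated by [phi]. *)
Lemma norm2_rot v (alpha : 'I_n -> R) (phi delta : R) :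
  cnorm2 v = 1 -> (forall k, is_angle (v k 0) (alpha k)) ->
  is_angle (mx11 (v^T *m v)) delta ->
  norm2 (\col_k (cmod (v k 0) * cos (phi + alpha k))) =
  Num.sqrt ((1 + V1 v * cos (2 * phi + delta)) / 2).
Proof.
move=> v1 hal hd; rewrite -(sum_Re_rot_sqr phi v1 hd); congr Num.sqrt.
apply: eq_bigr => k _; rewrite mxE (Re_angle (hal k)) (Im_angle (hal k)) cosD.
by ring.
Qed.

(* Since A is real, the real part of A v = lam v reads Im lam * Im v = 0 once
   Re v = 0. *)
Lemma imaginary_eigenvector_eq0 A lam v :
  cplx_mx A *m v = lam *: v -> complex.Im lam != 0 ->
  (forall k, complex.Re (v k 0) = 0) -> v = 0.
Proof.
move=> Av lamN0 Rev0; apply/matrixP => k j; rewrite ord1 mxE.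
have /(congr1 (@complex.Re R)) : (cplx_mx A *m v) k 0 = (lam *: v) k 0.
  by rewrite Av.
rewrite !mxE Re_sum big1 => [|l _]; last first.
  by rewrite mxE; have := Rev0 l; case: (v l 0) => a b /= ->; ring.
have := Rev0 k; case: (v k 0) => a b /= ->; case: lam lamN0 {Av} => p q /= qN0.
move/eqP; rewrite mulr0 sub0r eq_sym oppr_eq0 mulf_eq0 (negbTE qN0) /=.
by move/eqP=> ->.
Qed.

(* If V1 = 1, then at the phase where 1 + V1 cos vanishes the rotated
   eigenvector would be purely imaginary. *)
Lemma V1_lt1 A lam v :
  cplx_mx A *m v = lam *: v -> complex.Im lam != 0 -> cnorm2 v = 1 ->
  V1 v < 1.
Proof.
move=> Av lamN0 v1; have [delta hd] := polar_form (mx11 (v^T *m v)).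
pose phi := (pi - delta) / 2; pose u := (cos phi +i* sin phi) *: v.
have uE k : complex.Re (u k 0) =
    cos phi * complex.Re (v k 0) - sin phi * complex.Im (v k 0).
  by rewrite mxE; case: (v k 0).
have := sum_Re_rot_sqr phi v1 hd.
have -> : 2 * phi + delta = pi by rewrite /phi; field.
rewrite cospi => sumE; rewrite ltNge; apply/negP => V1ge1.
have u0 : u = 0.
  apply: (imaginary_eigenvector_eq0 (A := A) _ lamN0).
    (* A rotation is a scalar multiple, so [u] still satisfies the eigenvector equation for
       [lam]. *)
    by rewrite -scalemxAr Av !scalerA mulrC.
  have sum0 : \sum_k complex.Re (u k 0) ^+ 2 = 0.
    apply/eqP; rewrite eq_le sumr_ge0 => [|k _]; last exact: sqr_ge0.
    (* At this phase the sum equals [(1 - V1 v) / 2], which is at most 0 when [V1 v] is at least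
       1. *)
    by rewrite andbT; under eq_bigr do rewrite uE; rewrite sumE; lra.
  move=> k; apply/eqP; rewrite -sqrf_eq0; apply/eqP.
  by apply: (psumr_eq0P _ sum0) => // l _; exact: sqr_ge0.
have eN0 : cos phi +i* sin phi != 0.
  rewrite eq_complex /=; apply/negP => /andP[/eqP c0 /eqP s0].
  by have /eqP := cos2Dsin2 phi; rewrite c0 s0 expr0n addr0 eq_sym oner_eq0.
move/eqP: u0; rewrite scaler_eq0 (negbTE eN0) /= => /eqP v0.
have /eqP := cnorm2_col_sqr v.
rewrite v1 expr1n v0 big1 ?oner_eq0 // => k _.
by rewrite mxE /= expr0n addr0.
Qed.

Lemma V1_ge0 v : 0 <= V1 v.
Proof. exact: cmod_ge0. Qed.

Lemma range_OT v (omega : R) (alpha : 'I_n -> R) (gamma : 'cV[R]_n -> R)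
    (y0 z0 : 'cV[R]_n) :
  omega != 0 -> cnorm2 v = 1 -> V1 v < 1 ->
  (forall k, is_angle (v k 0) (alpha k)) ->
  range (fun t => OT omega v alpha gamma t y0 z0) =
  Num.sqrt @` range (fun a =>
    fVW (V1 v) (V1 v) a (2 * (gamma z0 - gamma (normalize y0)) - pi)).
Proof.
move=> omegaN0 v1 V1lt1 hal; have [delta hd] := polar_form (mx11 (v^T *m v)).
set gy := gamma (normalize y0).
have OTE t : OT omega v alpha gamma t y0 z0 =
    Num.sqrt (fVW (V1 v) (V1 v) (2 * (omega * t + gy) + delta + pi)
      (2 * (gamma z0 - gy) - pi)).
  have ThetaE u : norm2 (Theta omega v alpha gamma t u) =
      Num.sqrt ((1 + V1 v * cos (2 * (omega * t + gamma u) + delta)) / 2).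
    rewrite -(norm2_rot _ v1 hal hd); congr norm2.
    by apply/matrixP => k j; rewrite !mxE addrAC.
  have numE u : 0 <= (1 + V1 v * cos u) / 2.
    by have := Vcos_bound (V1_ge0 v) V1lt1 u; lra.
  (* Both radicands are nonnegative by [numE], so the quotient of roots is the root of the
     quotient. *)
  rewrite /OT !ThetaE -sqrtrV // -sqrtrM //; congr Num.sqrt.
  (* The shift by [pi] in the angle turns the minus sign in the denominator of [fVW] into a plus; in
     the numerator it cancels against the [- pi] of the second argument. *)
  rewrite /fVW -/gy cosDpi mulrN opprK.
  have -> : 2 * (gamma z0 - gy) - pi + (2 * (omega * t + gy) + delta + pi) =
    2 * (omega * t + gamma z0) + delta by ring.
  field; apply: lt0r_neq0.
  by have := Vcos_bound (V1_ge0 v) V1lt1 (2 * (omega * t + gy) + delta); lra.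
apply/seteqP; split => [_ [t _ <-]|_ [_ [a _ <-] <-]].
  by rewrite OTE; eexists => //; eexists.
(* The witness solves [2 * (omega * t + gy) + delta + pi = a] for [t], which is possible since
   [omega] is nonzero. *)
exists (((a - pi - delta) / 2 - gy) / omega) => //; rewrite OTE.
by congr (Num.sqrt (fVW _ _ _ _)); field.
Qed.

Lemma jordan_chain_eigenvector A lam v s :
  jordan_chain (cplx_mx A) lam (v :: s) -> v != 0 /\ cplx_mx A *m v = lam *: v.
Proof.
(* At index 0 the right-hand side of the chain equation is the 0 put in front of the chain. *)
move=> [_ vN0 /(_ 0 isT) /eqP]; rewrite /= mulmxBl subr_eq0 mul_scalar_mx.
by move=> /eqP; split.
Qed.

End Oscillation.

Theorem theorem20 (R : realType) (n : nat) (A : 'M[R]_n)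
    (lam1 : R[i]) (V : 'M[R[i]]_n) (bs : seq (R[i] * seq 'I_n))
    (k1 : 'I_n) (c1 : seq 'I_n) (k1' : 'I_n) (c1' : seq 'I_n)
    (v1 : 'cV[R[i]]_n) (w1 : 'rV[R[i]]_n)
    (alpha : 'I_n -> R) (gamma : 'cV[R]_n -> R) (y0 z0 : 'cV[R]_n)
    (hA : single_complex A)
    (hlam1 : rightmost A lam1)
    (homega1 : 0 < complex.Im lam1)
    (hV : jordan_basis A V bs)
    (hc1 : longest_chain bs lam1 (k1 :: c1))
    (hc1' : longest_chain bs (lam1^*) (k1' :: c1'))
    (hconjV : [seq col j V | j <- k1' :: c1'] =
              [seq conj_mx (col j V) | j <- k1 :: c1])
    (hv1 : v1 = col k1 V)
    (hw1 : w1 = row (last k1 c1) (invmx V))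
    (hconjW : row (last k1' c1') (invmx V) = conj_mx w1)
    (halpha : forall k, is_angle (cnormalize v1 k 0) (alpha k))
    (hgamma : forall u : 'cV[R]_n,
        mx11 (cnormalize w1 *m cplx_mx u) != 0 ->
        is_angle (mx11 (cnormalize w1 *m cplx_mx u)) (gamma u))
    (hz0 : norm2 z0 = 1)
    (hwy0 : mx11 (w1 *m cplx_mx y0) != 0)
    (hwz0 : mx11 (w1 *m cplx_mx z0) != 0) :
  is_max (range (fun t : R =>
      OT (complex.Im lam1) (cnormalize v1) alpha gamma t y0 z0))
    (Gmax (V1 (cnormalize v1)) (gamma z0 - gamma (normalize y0))) /\
  is_min (range (fun t : R =>
      OT (complex.Im lam1) (cnormalize v1) alpha gamma t y0 z0))
    (Gmin (V1 (cnormalize v1)) (gamma z0 - gamma (normalize y0))).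
Proof.
have [_ _ /(_ _ hc1.1) /=] := hV; rewrite -hv1.
move=> /jordan_chain_eigenvector[v1N0 Av1].
have omegaN0 : complex.Im lam1 != 0 by rewrite gt_eqF.
have nv1 := cnorm2_cnormalize v1N0.
have V1lt1 : V1 (cnormalize v1) < 1.
  (* Normalizing [v1] only rescales it, so it remains an eigenvector for the non-real [lam1]. *)
  apply: (V1_lt1 (A := A) _ omegaN0 nv1).
  by rewrite -scalemxAr Av1 !scalerA mulrC.
rewrite range_OT //; split.
  by apply/is_max_sqrt/fmaxP => //; exact: V1_ge0.
by apply/is_min_sqrt/fminP => //; exact: V1_ge0.
Qed.
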